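(* Let $X$ be a smooth Banach space over $\mathbb{C}$ and let $T\in B(X)$ be such that $r(T)=\|T\|$. Then $T$ attains its norm if it attains its numerical radius. In particular, for self-adjoint operators on $X$, the attainment of the numerical radius implies the attainment of the norm.
   Context: $B(X)$ is the space of bounded linear operators on $X$, $S_X=\{x\in X:\|x\|=1\}$, $X^*$ is the space of bounded linear functionals on $X$. $X$ is smooth if every $x\in S_X$ admits a unique $x^*\in S_{X^*}$ with $x^*(x)=1$. The duality mapping $J:X\to X^*$ of a smooth Banach space assigns to each $x$ the unique functional $J(x)$ with $\|J(x)\|=\|x\|$ and $J(x)(x)=\|x\|^2$. For $T\in B(X)$ the transpose $T':X^*\to X^*$ is $(T'f)(x)=f(Tx)$. $T\in B(X)$ is self-adjoint if $T'\circ J=J\circ T$. The numerical range is $W(T)=\{x^*(Tx):x\in S_X,\ x^*\in S_{X^*},\ x^*(x)=1\}$ (so $W(T)=\{J(x)(Tx):x\in S_X\}$), and the numerical radius is $r(T)=\sup\{|\lambda|:\lambda\in W(T)\}$. $T$ attains its numerical radius if there is $x_1\in S_X$ with $|J(x_1)(Tx_1)|=r(T)$; $T$ attains its norm if there is $x_1\in S_X$ with $\|Tx_1\|=\|T\|$. *)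

(* Defs.v *)
From Stdlib Require Export Reals ClassicalEpsilon.
From Coquelicot Require Export Coquelicot.

Open Scope R_scope.

(** [is_linear] requires additivity, homogeneity and boundedness. *)
Record bounded_op (U V : NormedModule C_AbsRing) : Type := BoundedOp {
  bounded_op_fun :> U -> V;
  bounded_op_is_linear : is_linear bounded_op_fun
}.

Arguments BoundedOp {U V} _ _.
Arguments bounded_op_fun {U V} _ _.
Arguments bounded_op_is_linear {U V} _.

(** The norm of [C_NormedModule] is the complex modulus [Cmod]. *)
Definition dual (X : NormedModule C_AbsRing) : Type :=
  bounded_op X C_NormedModule.

(** The supremum is over the closed unit ball, a non-empty set even when
    [X] is the zero space; it is finite since operators are bounded. *)
Definition op_norm {U V : NormedModule C_AbsRing} (T : bounded_op U V) : R :=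
  real (Lub_Rbar (fun r : R => exists x : U, norm x <= 1 /\ r = norm (T x))).

Definition smooth (X : NormedModule C_AbsRing) : Prop :=
  forall x : X, norm x = 1 ->
    exists! f : dual X, op_norm f = 1 /\ f x = RtoC 1.

Definition dual_zero (X : NormedModule C_AbsRing) : dual X :=
  BoundedOp (fun _ : X => zero : C_NormedModule) is_linear_zero.

(** When [X] is smooth the functional [f] below exists and is unique for every
    [x]. For a general [X] the value need not be canonical. *)
Definition duality_map {X : NormedModule C_AbsRing} (x : X) : dual X :=
  epsilon (inhabits (dual_zero X))
    (fun f : dual X => op_norm f = norm x /\ f x = RtoC (norm x ^ 2)).

Definition transpose {X : NormedModule C_AbsRing}
    (T : bounded_op X X) (f : dual X) : dual X :=
  BoundedOp (fun x : X => f (T x))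
    (is_linear_comp T f (bounded_op_is_linear T) (bounded_op_is_linear f)).

Definition self_adjoint {X : NormedModule C_AbsRing}
    (T : bounded_op X X) : Prop :=
  forall x : X, transpose T (duality_map x) = duality_map (T x).

Definition numerical_range {X : NormedModule C_AbsRing}
    (T : bounded_op X X) (lambda : C) : Prop :=
  exists (x : X) (f : dual X),
    norm x = 1 /\ op_norm f = 1 /\ f x = RtoC 1 /\ lambda = f (T x).

(** The set of moduli is bounded by [op_norm T]; for the zero space it is
    empty, and [real] then gives the value 0. *)
Definition numerical_radius {X : NormedModule C_AbsRing}
    (T : bounded_op X X) : R :=
  real (Lub_Rbar (fun r : R =>
    exists lambda : C, numerical_range T lambda /\ r = Cmod lambda)).

Definition attains_numerical_radius {X : NormedModule C_AbsRing}
    (T : bounded_op X X) : Prop :=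
  exists x1 : X, norm x1 = 1 /\
    Cmod (duality_map x1 (T x1)) = numerical_radius T.

Definition attains_norm {X : NormedModule C_AbsRing}
    (T : bounded_op X X) : Prop :=
  exists x1 : X, norm x1 = 1 /\ norm (T x1) = op_norm T.

(* Main.v *)
Require Import Defs.
From Stdlib Require Import ssreflect Reals Lra Lia.
From Coquelicot Require Import Coquelicot.

(** If [x] is a unit vector at which the numerical radius is attained, then
    [numerical_radius T = |J x (T x)| <= norm (T x) <= op_norm T], so the norm
    is attained at [x] as soon as [op_norm T <= numerical_radius T]
    ([attains_norm_of_op_norm_le]). What remains is this inequality for a
    self-adjoint operator.

    Self-adjointness enters once: [J x (T (T x)) = J (T x) (T x)], which is
    [norm (T x) ^ 2], so [norm (T x) ^ 2 <= norm (T (T x)) * norm x]. Such an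
    operator is called paranormal. Its powers satisfy
    [op_norm (T ^ n) = op_norm T ^ n], its spectral radius is [op_norm T], and
    the spectrum lies in the closure of the numerical range. The proof below
    is an elementary version of this argument, in which no resolvent is ever
    constructed; lower bounds on [1 - z T] are enough.

    Write [a] and [r] for the norm and the numerical radius, and suppose
    [r < a].
    A functional supporting [x] gives
    [norm ((1 - z T) x) >= (1 - |z| r) * norm x] ([norm_sub_scal_op_ge]), so
    where [|z| r < 1] the would-be resolvent [1 / (1 - z T)] is bounded by some
    [M], and between the two circles [|z| = t] and [|z| = s] it varies by at
    most [d = (t - s) * a * M ^ 2] along each ray ([circle_gap_op]). From
      [1 / (1 - z ^ 2 T ^ 2) = (1 / (1 - z T) + 1 / (1 + z T)) / 2]
    the resolvent of [T ^ 2], on the circles of radii [t ^ 2] and [s ^ 2],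
    varies by at most the same [d] ([circle_gap_square]); hence so does that of
    every [T ^ m] with [m = 2 ^ k].

    Choose [s < 1 / a < t] so close that [d = 1 / 4]. For large [k] the operator
    [s ^ m T ^ m] is small, so its resolvent at 1 is close to the identity, and
    so is that of [t ^ m T ^ m], which forces [norm (t ^ m T ^ m x) <= 1] on
    unit vectors ([scal_op_contraction]). Paranormality brings this back to
    [t * norm (T x) <= 1] ([paranormal_scal_op_le]), hence [a <= 1 / t < a]. *)

(** * Suprema of bounded sets and the operator norm *)

Lemma real_Lub_ge (E : R -> Prop) (M : R) :
  (forall r, E r -> r <= M) -> forall r, E r -> r <= real (Lub_Rbar E).
Proof.
  intros HM r Hr.
  destruct (Lub_Rbar_correct E) as [Hub Hlub].
  specialize (Hub r Hr). specialize (Hlub (Finite M) HM).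
  destruct (Lub_Rbar E); simpl in *; tauto.
Qed.

Lemma real_Lub_le (E : R -> Prop) (M : R) :
  (exists r, E r) -> (forall r, E r -> r <= M) -> real (Lub_Rbar E) <= M.
Proof.
  intros [r Hr] HM.
  destruct (Lub_Rbar_correct E) as [Hub Hlub].
  specialize (Hub r Hr). specialize (Hlub (Finite M) HM).
  destruct (Lub_Rbar E); simpl in *; tauto.
Qed.

Lemma norm_scal_C (X : NormedModule C_AbsRing) (c : C) (x : X) :
  norm (scal (c : C_AbsRing) x) = Cmod c * norm x.
Proof.
  apply Rle_antisym; [exact (norm_scal (c : C_AbsRing) x)|].
  destruct (Ceq_dec c (RtoC 0)) as [->|Hc].
  - rewrite Cmod_0 Rmult_0_l. apply norm_ge_0.
  - assert (Hx : x = scal (Cinv c : C_AbsRing) (scal (c : C_AbsRing) x)).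
    { rewrite scal_assoc.
      replace (mult (Cinv c : C_AbsRing) (c : C_AbsRing)) with (one : C_AbsRing).
      - now rewrite scal_one.
      - symmetry. exact (Cinv_l c Hc). }
    pose proof (norm_scal (Cinv c : C_AbsRing) (scal (c : C_AbsRing) x)) as H.
    rewrite -Hx in H.
    change (abs (Cinv c : C_AbsRing)) with (Cmod (Cinv c)) in H.
    rewrite (Cmod_inv c Hc) in H.
    pose proof (Cmod_gt_0 c) as [Hpos _]. specialize (Hpos Hc).
    apply (Rmult_le_compat_l (Cmod c)) in H; [|lra].
    rewrite -Rmult_assoc Rinv_r in H; lra.
Qed.

Lemma exists_normalized (X : NormedModule C_AbsRing) (x : X) :
  norm x <> 0 ->
  exists e : X, norm e = 1 /\ x = scal (RtoC (norm x) : C_AbsRing) e.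
Proof.
  intros Hx.
  assert (Hpos : 0 < norm x) by (pose proof (norm_ge_0 x); lra).
  exists (scal (RtoC (/ norm x) : C_AbsRing) x). split.
  - rewrite norm_scal_C Cmod_R Rabs_pos_eq.
    + now field.
    + left; now apply Rinv_0_lt_compat.
  - rewrite scal_assoc.
    replace (mult (RtoC (norm x) : C_AbsRing) (RtoC (/ norm x)))
      with (one : C_AbsRing).
    + now rewrite scal_one.
    + symmetry. change (RtoC (norm x) * RtoC (/ norm x) = RtoC 1)%C.
      rewrite -RtoC_mult. f_equal. now field.
Qed.

Section OperatorNorm.
Context {U V : NormedModule C_AbsRing} (T : bounded_op U V).

Lemma norm_op_le_unit_ball (x : U) : norm x <= 1 -> norm (T x) <= op_norm T.
Proof.
  intros Hx.
  destruct (linear_norm T (bounded_op_is_linear T)) as [M [HM0 HM]].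
  apply (real_Lub_ge _ M); [|now exists x].
  intros r [y [Hy ->]]. specialize (HM y).
  pose proof (norm_ge_0 y). nra.
Qed.

Lemma norm_op_le (x : U) : norm (T x) <= op_norm T * norm x.
Proof.
  destruct (Req_dec (norm x) 0) as [H0|Hx].
  - rewrite (norm_eq_zero x H0) (linear_zero T (bounded_op_is_linear T)).
    rewrite !norm_zero. lra.
  - destruct (exists_normalized U x Hx) as [e [He Hxe]].
    pose proof (norm_ge_0 x).
    rewrite {1}Hxe.
    rewrite (linear_scal T (bounded_op_is_linear T)) norm_scal_C Cmod_R.
    rewrite Rabs_pos_eq //.
    assert (norm (T e) <= op_norm T) by (apply norm_op_le_unit_ball; lra).
    nra.
Qed.

Lemma op_norm_le (c : R) :
  (forall x, norm x <= 1 -> norm (T x) <= c) -> op_norm T <= c.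
Proof.
  intros Hc. apply real_Lub_le.
  - exists (norm (T zero)), zero. rewrite norm_zero. split; [lra|easy].
  - intros r [x [Hx ->]]. now apply Hc.
Qed.

Lemma op_norm_ge_0 : 0 <= op_norm T.
Proof.
  apply Rle_trans with (norm (T zero)); [apply norm_ge_0|].
  apply norm_op_le_unit_ball. rewrite norm_zero. lra.
Qed.

Lemma op_norm_eq (c : R) (x : U) :
  (forall y, norm (T y) <= c * norm y) -> 0 <= c ->
  norm x = 1 -> norm (T x) = c -> op_norm T = c.
Proof.
  intros Hc Hc0 Hx HTx. apply Rle_antisym.
  - apply op_norm_le. intros y Hy. specialize (Hc y).
    pose proof (norm_ge_0 y). nra.
  - rewrite -HTx. apply norm_op_le_unit_ball. lra.
Qed.

End OperatorNorm.

(** * Duality map and numerical range *)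

Section Smooth.
Context {X : NormedModule C_AbsRing} (hX : smooth X).

(** Smoothness supplies support functionals at unit vectors only; at any other
    nonzero [x] the functional at the normalized vector is rescaled by
    [norm x]. *)
Lemma duality_map_spec (x : X) :
  op_norm (duality_map x) = norm x /\
  duality_map x x = RtoC (norm x ^ 2).
Proof.
  unfold duality_map. apply epsilon_spec.
  destruct (Req_dec (norm x) 0) as [H0|Hx].
  - exists (dual_zero X). rewrite H0. split.
    + apply Rle_antisym; [|apply op_norm_ge_0].
      apply op_norm_le. intros y _. simpl.
      rewrite (norm_zero (V := C_NormedModule)). lra.
    + simpl. rewrite Rmult_0_l. reflexivity.
  - destruct (exists_normalized X x Hx) as [e [He Hxe]].
    destruct (hX e He) as [f [[Hf Hfe] _]].
    set (c := RtoC (norm x)).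
    assert (Hmod : Cmod c = norm x).
    { unfold c. rewrite Cmod_R. apply Rabs_pos_eq, norm_ge_0. }
    set (g := BoundedOp (fun y : X => scal (c : C_AbsRing) (f y))
      (is_linear_comp f _ (bounded_op_is_linear f)
         (is_linear_scal_r (V := C_NormedModule) (c : C_AbsRing) Cmult_comm))).
    assert (Hg : forall y, norm (g y) = norm x * norm (f y)).
    { intros y. simpl. rewrite (norm_scal_C C_NormedModule c (f y)).
      now rewrite Hmod. }
    exists g. split.
    + apply (op_norm_eq g (norm x) e).
      * intros y. rewrite Hg. pose proof (norm_op_le f y) as H.
        rewrite Hf in H. pose proof (norm_ge_0 x). nra.
      * apply norm_ge_0.
      * easy.
      * rewrite Hg Hfe. change (norm x * Cmod (RtoC 1) = norm x).
        rewrite Cmod_1. ring.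
    + rewrite {1}Hxe.
      rewrite (linear_scal g (bounded_op_is_linear g)).
      change (c * (c * f e) = RtoC (norm x ^ 2))%C.
      rewrite Hfe. unfold c. rewrite Cmult_1_r -RtoC_mult.
      f_equal. ring.
Qed.

(** The real part of [Lub_Rbar] is an upper bound because the numerical range
    is bounded by the operator norm. *)
Lemma Cmod_numerical_range_le (T : bounded_op X X) (x : X) (f : dual X) :
  norm x = 1 -> op_norm f = 1 -> f x = RtoC 1 ->
  Cmod (f (T x)) <= numerical_radius T.
Proof.
  intros Hx Hf Hfx.
  apply (real_Lub_ge _ (op_norm T)).
  - intros r [l [[y [g [Hy [Hg [_ ->]]]]] ->]].
    pose proof (norm_op_le g (T y)) as H1.
    pose proof (norm_op_le T y) as H2.
    rewrite Hg in H1. rewrite Hy in H2.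
    change (norm (g (T y))) with (Cmod (g (T y))) in H1. lra.
  - exists (f (T x)). split; [|easy].
    now exists x, f.
Qed.

(** If [f] supports the unit vector [x], then [f (x - z T x)] equals
    [1 - z f (T x)], and [f (T x)] lies in the numerical range. *)
Lemma norm_sub_scal_op_ge (T : bounded_op X X) (z : C) (x : X) :
  (1 - Cmod z * numerical_radius T) * norm x <=
  norm (minus x (scal (z : C_AbsRing) (T x))).
Proof.
  destruct (Req_dec (norm x) 0) as [H0|Hx].
  { rewrite H0 Rmult_0_r. apply norm_ge_0. }
  destruct (exists_normalized X x Hx) as [e [He Hxe]].
  destruct (hX e He) as [f [[Hf Hfe] _]].
  assert (Hunit : 1 - Cmod z * numerical_radius T <=
                  norm (minus e (scal (z : C_AbsRing) (T e)))).
  { pose proof (Cmod_numerical_range_le T e f He Hf Hfe) as Hr.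
    pose proof (norm_op_le f (minus e (scal (z : C_AbsRing) (T e)))) as H.
    rewrite Hf Rmult_1_l in H.
    eapply Rle_trans; [|exact H].
    rewrite (linear_minus f _ _ (bounded_op_is_linear f)).
    rewrite (linear_scal f (bounded_op_is_linear f)) Hfe.
    change (1 - Cmod z * numerical_radius T
            <= Cmod (RtoC 1 - z * f (T e))%C).
    pose proof (Cmod_triangle (RtoC 1 - z * f (T e)) (z * f (T e))) as Ht.
    replace (RtoC 1 - z * f (T e) + z * f (T e))%C with (RtoC 1) in Ht by ring.
    rewrite Cmod_1 Cmod_mult in Ht.
    pose proof (Cmod_ge_0 z). nra. }
  assert (Heq : minus x (scal (z : C_AbsRing) (T x)) =
                scal (RtoC (norm x) : C_AbsRing)
                     (minus e (scal (z : C_AbsRing) (T e)))).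
  { etransitivity;
      [|symmetry;
        exact (linear_minus _ _ _
          (is_linear_scal_r (V := X) (RtoC (norm x) : C_AbsRing) Cmult_comm))].
    rewrite {1 2}Hxe. f_equal.
    rewrite (linear_scal T (bounded_op_is_linear T)) !scal_assoc.
    f_equal. apply Cmult_comm. }
  pose proof (norm_ge_0 x) as Hn.
  rewrite Heq norm_scal_C Cmod_R Rabs_pos_eq //.
  nra.
Qed.

End Smooth.

(** * Identities in abelian groups *)

Section GroupIdentities.
Context {G : AbelianGroup}.

Lemma minus_plus_telescope (a b c : G) :
  minus (plus a b) (plus b c) = minus a c.
Proof.
  rewrite /minus opp_plus -plus_assoc (plus_assoc b (opp b)).
  by rewrite plus_opp_r plus_zero_l.
Qed.

Lemma plus_plus_swap (a b c e : G) :
  plus (plus a b) (plus c e) = plus (plus a c) (plus b e).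
Proof. by rewrite -!plus_assoc (plus_assoc b) (plus_comm b c) -plus_assoc. Qed.

Lemma minus_plus_plus (a b c e : G) :
  minus (plus a b) (plus c e) = plus (minus a c) (minus b e).
Proof. by rewrite /minus opp_plus plus_plus_swap. Qed.

Lemma minus_minus_swap (a b c e : G) :
  minus (minus a b) (minus c e) = minus (minus a c) (minus b e).
Proof. by rewrite /minus !opp_plus plus_plus_swap. Qed.

Lemma minus_plus_minus_self (a b : G) :
  minus (plus a b) (minus a b) = plus b b.
Proof. by rewrite /minus opp_plus opp_opp plus_plus_swap plus_opp_r plus_zero_l. Qed.

(** With [a = x], [b = v x], [c = u x], [e = u (v x)] the left side is
    [(1 + u) (1 + v) x - (1 - u) (1 - v) x]: only the odd part survives. *)
Lemma minus_plus_plus_minus_minus (a b c e : G) :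
  minus (plus (plus a b) (plus c e)) (minus (minus a b) (minus c e)) =
  plus (plus c b) (plus c b).
Proof.
  have -> : minus (minus a b) (minus c e) = minus (plus a e) (plus c b).
  { by rewrite minus_minus_swap minus_plus_plus {1}/minus opp_minus. }
  have -> : plus (plus a b) (plus c e) = plus (plus a e) (plus c b).
  { by rewrite (plus_comm c e) plus_plus_swap (plus_comm b c). }
  exact: minus_plus_minus_self.
Qed.

End GroupIdentities.

(** * Comparing resolvents of an operator and of its square *)

Section ResolventGap.
Context {X : NormedModule C_AbsRing}.

Definition one_minus (u : X -> X) (x : X) : X := minus x (u x).

(** For commuting [u] and [v] with [1 - u] and [1 - v] invertible this says that
    [1 / (1 - u) - 1 / (1 - v)] has norm at most [d]; clearing denominators
    keeps it meaningful without the inverses. *)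
Definition resolvent_gap (d : R) (u v : X -> X) : Prop :=
  forall x, norm (minus (u x) (v x)) <= d * norm (one_minus u (one_minus v x)).

Definition neg (u : X -> X) (x : X) : X := opp (u x).

Lemma norm_plus_self (x : X) : norm (plus x x) = 2 * norm x.
Proof.
  replace (plus x x) with (scal (RtoC 2 : C_AbsRing) x).
  - rewrite norm_scal_C Cmod_R Rabs_pos_eq; lra.
  - replace (RtoC 2 : C_AbsRing)
      with (plus (one : C_AbsRing) (one : C_AbsRing)).
    + now rewrite scal_distr_r scal_one.
    + change (RtoC 1 + RtoC 1 = RtoC 2)%C. rewrite -RtoC_plus. f_equal; ring.
Qed.

Lemma norm_minus_le (x y : X) : norm (minus x y) <= norm x + norm y.
Proof. rewrite -(norm_opp y). apply norm_triangle. Qed.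

Lemma one_minus_neg (u : X -> X) (x : X) : one_minus (neg u) x = plus x (u x).
Proof. unfold one_minus, neg, minus. now rewrite opp_opp. Qed.

Lemma one_minus_square (u : X -> X) (hu : is_linear u) (x : X) :
  one_minus u (one_minus (neg u) x) = one_minus (fun y => u (u y)) x.
Proof.
  rewrite one_minus_neg. unfold one_minus.
  now rewrite (linear_plus u hu) minus_plus_telescope.
Qed.

Lemma one_minus_comm (u v : X -> X) (hu : is_linear u) (hv : is_linear v)
    (huv : forall x, u (v x) = v (u x)) (x : X) :
  one_minus u (one_minus v x) = one_minus v (one_minus u x).
Proof.
  unfold one_minus.
  rewrite (linear_minus v _ _ hv) (linear_minus u _ _ hu) huv.
  by rewrite minus_minus_swap.
Qed.

Lemma is_linear_neg (u : X -> X) : is_linear u -> is_linear (neg u).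
Proof. intros hu. exact (is_linear_comp u opp hu is_linear_opp). Qed.

Lemma one_minus_neg_comm (u v : X -> X) (hu : is_linear u) (hv : is_linear v)
    (huv : forall x, u (v x) = v (u x)) (x : X) :
  one_minus v (one_minus (neg u) x) = one_minus (neg u) (one_minus v x).
Proof.
  apply one_minus_comm; [easy|now apply is_linear_neg|].
  intros y. unfold neg. now rewrite (linear_opp v _ hv) huv.
Qed.

(** The resolvent of [u ^ 2] is the mean of those of [u] and [- u], so a bound
    on the variation of both is inherited. Without denominators: let
    [yp = (1 + u) (1 + v) x], [ym = (1 - u) (1 - v) x] and [D = u - v]. Both
    [(1 - u) (1 - v) yp] and [(1 + u) (1 + v) ym] are
    [(1 - u ^ 2) (1 - v ^ 2) x], while [yp - ym = 2 (u + v) x], so that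
    [D yp - D ym = 2 (u ^ 2 - v ^ 2) x]. *)
Lemma resolvent_gap_square (d : R) (u v : X -> X)
    (hu : is_linear u) (hv : is_linear v)
    (huv : forall x, u (v x) = v (u x)) :
  resolvent_gap d u v -> resolvent_gap d (neg u) (neg v) ->
  resolvent_gap d (fun x => u (u x)) (fun x => v (v x)).
Proof.
  intros Hp Hm x.
  set (D := fun y => minus (u y) (v y)).
  set (P := one_minus (fun x => u (u x)) (one_minus (fun x => v (v x)) x)).
  set (yp := one_minus (neg u) (one_minus (neg v) x)).
  set (ym := one_minus u (one_minus v x)).
  assert (Hyp : one_minus u (one_minus v yp) = P).
  { unfold yp, P. rewrite (one_minus_neg_comm u v hu hv huv).
    now rewrite (one_minus_square u hu) (one_minus_square v hv). }
  assert (Hym : one_minus (neg u) (one_minus (neg v) ym) = P).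
  { unfold ym, P.
    rewrite -(one_minus_neg_comm v u hv hu); [|now intros; rewrite huv].
    rewrite -(one_minus_square u hu) -(one_minus_square v hv).
    rewrite -(one_minus_neg_comm u u hu hu) //.
    rewrite -(one_minus_neg_comm v v hv hv) //. }
  assert (Hy : minus yp ym = plus (plus (u x) (v x)) (plus (u x) (v x))).
  { unfold yp, ym. rewrite !one_minus_neg. unfold one_minus.
    rewrite (linear_plus u hu) (linear_minus u _ _ hu).
    by rewrite minus_plus_plus_minus_minus. }
  assert (HDadd : forall a b, D (plus a b) = plus (D a) (D b)).
  { intros a b. unfold D.
    rewrite (linear_plus u hu) (linear_plus v hv). by rewrite minus_plus_plus. }
  assert (HDm : D (minus yp ym) = minus (D yp) (D ym)).
  { rewrite {1}/minus HDadd {1}/minus. f_equal.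
    unfold D. rewrite (linear_opp u _ hu) (linear_opp v _ hv).
    unfold minus. now rewrite opp_plus. }
  assert (HDs : D (plus (u x) (v x)) = minus (u (u x)) (v (v x))).
  { unfold D. rewrite (linear_plus u hu) (linear_plus v hv) huv.
    by rewrite minus_plus_telescope. }
  specialize (Hp yp). specialize (Hm ym).
  rewrite Hyp in Hp. rewrite Hym in Hm.
  fold (D yp) in Hp.
  replace (norm (minus (neg u ym) (neg v ym))) with (norm (D ym)) in Hm.
  2: { unfold D, neg. rewrite -norm_opp. unfold minus.
       now rewrite opp_plus. }
  assert (H2 : 2 * norm (minus (u (u x)) (v (v x))) = norm (minus (D yp) (D ym))).
  { rewrite -HDs -norm_plus_self -HDadd -Hy. now rewrite HDm. }
  assert (Ht : norm (minus (D yp) (D ym)) <= norm (D yp) + norm (D ym)).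
  { apply norm_minus_le. }
  lra.
Qed.

(** Parametrizing a circle by the angle makes square roots and negation explicit:
    they halve the angle and shift it by [PI]. *)
Definition polar (t theta : R) : C := (t * cos theta, t * sin theta).

Lemma Cmod_polar (t theta : R) : 0 <= t -> Cmod (polar t theta) = t.
Proof.
  intros Ht. unfold Cmod, polar; simpl.
  replace (t * cos theta * (t * cos theta * 1) +
           t * sin theta * (t * sin theta * 1))
    with (t * t * (Rsqr (sin theta) + Rsqr (cos theta)))
    by (unfold Rsqr; ring).
  rewrite sin2_cos2 Rmult_1_r. now apply sqrt_square.
Qed.

Lemma polar_square (t theta : R) :
  (polar t (theta / 2) * polar t (theta / 2))%C = polar (t ^ 2) theta.
Proof.
  set (phi := theta / 2).
  replace theta with (phi + phi) by (unfold phi; field).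
  unfold polar, Cmult; simpl.
  rewrite cos_plus sin_plus. f_equal; ring.
Qed.

Lemma polar_opp (t theta : R) : polar t (theta + PI) = (- polar t theta)%C.
Proof.
  unfold polar, Copp; simpl. rewrite neg_cos neg_sin. f_equal; ring.
Qed.

Definition polar_scal (t theta : R) (A : X -> X) (x : X) : X :=
  scal (polar t theta : C_AbsRing) (A x).

Definition circle_gap (d t s : R) (A : X -> X) : Prop :=
  forall theta, resolvent_gap d (polar_scal t theta A) (polar_scal s theta A).

Lemma is_linear_polar_scal (t theta : R) (A : X -> X) :
  is_linear A -> is_linear (polar_scal t theta A).
Proof.
  intros hA. apply (is_linear_comp A _ hA).
  apply (is_linear_scal_r (polar t theta : C_AbsRing) Cmult_comm).
Qed.

Lemma polar_scal_comm (t s theta : R) (A : X -> X) (hA : is_linear A) (x : X) :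
  polar_scal t theta A (polar_scal s theta A x) =
  polar_scal s theta A (polar_scal t theta A x).
Proof.
  unfold polar_scal. rewrite !(linear_scal A hA) !scal_assoc.
  f_equal. apply Cmult_comm.
Qed.

Lemma resolvent_gap_ext (d : R) (u v u' v' : X -> X) :
  (forall x, u x = u' x) -> (forall x, v x = v' x) ->
  resolvent_gap d u v -> resolvent_gap d u' v'.
Proof.
  intros Hu Hv H x. specialize (H x). unfold one_minus in *.
  now rewrite !Hu !Hv in H.
Qed.

(** Every point of the circle of radius [t ^ 2] is a square [z ^ 2] with
    [|z| = t], and [- z] lies on the same circle, so both hypotheses of
    [resolvent_gap_square] are available; [d] does not grow. *)
Lemma circle_gap_square (d t s : R) (A : X -> X) (hA : is_linear A) :
  circle_gap d t s A -> circle_gap d (t ^ 2) (s ^ 2) (fun x => A (A x)).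
Proof.
  intros H theta.
  assert (Hsq : forall r x, polar_scal r (theta / 2) A
                    (polar_scal r (theta / 2) A x) =
                  polar_scal (r ^ 2) theta (fun x => A (A x)) x).
  { intros r x. unfold polar_scal.
    rewrite (linear_scal A hA) scal_assoc. f_equal. apply polar_square. }
  assert (Hneg : forall r x, polar_scal r (theta / 2 + PI) A x =
                   neg (polar_scal r (theta / 2) A) x).
  { intros r x. unfold neg, polar_scal. rewrite polar_opp.
    exact (scal_opp_l (polar r (theta / 2) : C_AbsRing) (A x)). }
  apply (resolvent_gap_ext d _ _ _ _ (Hsq t) (Hsq s)).
  apply resolvent_gap_square.
  - now apply is_linear_polar_scal.
  - now apply is_linear_polar_scal.
  - now apply polar_scal_comm.
  - apply H.
  - apply (resolvent_gap_ext d _ _ _ _ (Hneg t) (Hneg s)), H.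
Qed.

Definition paranormal (A : X -> X) : Prop :=
  forall x, norm (A x) ^ 2 <= norm (A (A x)) * norm x.

(** The norms [a0], ..., [a4] of [x], [A x], ... are log-convex; multiply
    [a2 ^ 2 <= a1 * a3] by itself and use [a1 ^ 2 <= a0 * a2] and
    [a3 ^ 2 <= a2 * a4]. *)
Lemma paranormal_square (A : X -> X) :
  paranormal A -> paranormal (fun x => A (A x)).
Proof.
  intros H x.
  pose proof (H x) as H0. pose proof (H (A x)) as H1.
  pose proof (H (A (A x))) as H2.
  set (a0 := norm x) in *. set (a1 := norm (A x)) in *.
  set (a2 := norm (A (A x))) in *. set (a3 := norm (A (A (A x)))) in *.
  set (a4 := norm (A (A (A (A x))))) in *.
  assert (0 <= a0) by apply norm_ge_0. assert (0 <= a1) by apply norm_ge_0.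
  assert (0 <= a2) by apply norm_ge_0. assert (0 <= a3) by apply norm_ge_0.
  assert (0 <= a4) by apply norm_ge_0.
  assert (Hp : 0 <= a4 * a0) by (now apply Rmult_le_pos).
  destruct (Req_dec a2 0) as [->|Hn]; [lra|].
  assert (Ha2 : 0 < a2 ^ 2) by (apply pow_lt; lra).
  apply (Rmult_le_reg_l (a2 ^ 2)); [easy|].
  apply Rle_trans with ((a3 * a1) ^ 2).
  - rewrite -Rpow_mult_distr. apply pow_incr. nra.
  - rewrite Rpow_mult_distr.
    replace (a2 ^ 2 * (a4 * a0)) with ((a4 * a2) * (a2 * a0)) by ring.
    apply Rmult_le_compat; try easy; apply pow2_ge_0.
Qed.

(** Put [u = t A] and [v = s A]. On a unit vector the gap gives
    [norm (u x) - norm (v x) <= 1/4 * (1 + 1/4) * (1 + norm (u x))], and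
    [norm (v x) <= 1/4]; hence [11/16 * norm (u x) <= 9/16]. *)
Lemma scal_op_contraction (A : X -> X) (a t s : R) :
  is_linear A -> circle_gap (1/4) t s A -> 0 <= t -> 0 <= s ->
  (forall x, norm (A x) <= a * norm x) -> s * a <= 1/4 ->
  forall x, norm x = 1 -> t * norm (A x) <= 1.
Proof.
  intros hA Hgap Ht Hs Ha Hsa x Hx.
  specialize (Hgap 0 x).
  set (u := polar_scal t 0 A) in *. set (v := polar_scal s 0 A) in *.
  assert (Hu : norm (u x) = t * norm (A x)).
  { unfold u, polar_scal. now rewrite norm_scal_C Cmod_polar. }
  assert (Hv : forall y, norm (v y) <= 1/4 * norm y).
  { intros y. unfold v, polar_scal. rewrite norm_scal_C Cmod_polar //.
    specialize (Ha y). pose proof (norm_ge_0 y). nra. }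
  unfold u, v in Hgap.
  rewrite one_minus_comm in Hgap; try (now apply is_linear_polar_scal).
  2: { now apply polar_scal_comm. }
  fold u v in Hgap.
  set (y := one_minus u x) in *.
  assert (Hy : norm y <= 1 + norm (u x)).
  { rewrite -Hx. apply norm_minus_le. }
  assert (Hvy : norm (one_minus v y) <= norm y + norm (v y))
    by apply norm_minus_le.
  assert (Hux : norm (u x) <= norm (minus (u x) (v x)) + norm (v x)).
  { replace (u x) with (plus (minus (u x) (v x)) (v x)) at 1.
    - apply norm_triangle.
    - unfold minus. now rewrite -plus_assoc plus_opp_l plus_zero_r. }
  pose proof (Hv x) as Hvx. specialize (Hv y). rewrite Hx in Hvx.
  rewrite -Hu. lra.
Qed.

(** Each step of the induction replaces [A, a, t, s] by their squares: the
    gap is preserved, and the conclusion for [A ^ 2] gives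
    [(t * norm (A x)) ^ 2 <= t ^ 2 * norm (A (A x)) <= 1]. *)
Lemma paranormal_scal_op_le (k : nat) :
  forall (A : X -> X) (a t s : R),
  is_linear A -> paranormal A -> circle_gap (1/4) t s A -> 0 <= t -> 0 <= s ->
  0 <= a -> (forall x, norm (A x) <= a * norm x) -> (s * a) ^ (2 ^ k) <= 1/4 ->
  forall x, norm x = 1 -> t * norm (A x) <= 1.
Proof.
  induction k as [|k IH]; intros A a t s hA hpara hgap Ht Hs Ha0 Ha Hsa x Hx.
  - apply (scal_op_contraction A a t s); try easy. simpl in Hsa. lra.
  - assert (Hsq : t ^ 2 * norm (A (A x)) <= 1).
    { apply (IH (fun x => A (A x)) (a ^ 2) (t ^ 2) (s ^ 2)); try easy.
      - now apply is_linear_comp.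
      - now apply paranormal_square.
      - now apply circle_gap_square.
      - apply pow2_ge_0.
      - apply pow2_ge_0.
      - apply pow2_ge_0.
      - intros y. pose proof (Ha y). pose proof (Ha (A y)). nra.
      - now rewrite -Rpow_mult_distr -pow_mult. }
    specialize (hpara x). rewrite Hx Rmult_1_r in hpara.
    pose proof (norm_ge_0 (A x)). pose proof (pow2_ge_0 t).
    assert ((t * norm (A x)) ^ 2 <= 1).
    { rewrite Rpow_mult_distr. nra. }
    assert (0 <= t * norm (A x)) by now apply Rmult_le_pos.
    nra.
Qed.

Lemma exists_pow_pow2_le (q : R) :
  0 <= q < 1 -> exists k : nat, q ^ (2 ^ k) <= 1/4.
Proof.
  intros Hq.
  destruct (pow_lt_1_zero q) with (y := 1/4) as [N HN].
  - rewrite Rabs_pos_eq; lra.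
  - lra.
  - exists N. specialize (HN (2 ^ N)%nat).
    apply Rle_trans with (Rabs (q ^ (2 ^ N))); [apply Rle_abs|].
    left. apply HN. pose proof (Nat.pow_gt_lin_r 2 N). lia.
Qed.

End ResolventGap.

(** * Paranormal operators and the numerical radius *)

Section SmoothParanormal.
Context {X : NormedModule C_AbsRing} (hX : smooth X).

(** The resolvent identity
    [1 / (1 - z T) - 1 / (1 - w T) = (z - w) T / ((1 - z T) (1 - w T))],
    with each inverse bounded by [M]. *)
Lemma circle_gap_op (T : bounded_op X X) (M t s : R) :
  0 <= s <= t -> 0 <= numerical_radius T -> 0 <= M ->
  1 <= M * (1 - t * numerical_radius T) ->
  circle_gap ((t - s) * op_norm T * M ^ 2) t s T.
Proof.
  intros Hst Hr HM0 HM theta x.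
  set (u := polar_scal t theta T). set (v := polar_scal s theta T).
  assert (Hlow : forall c y, 0 <= c <= t ->
            norm y <= M * norm (one_minus (polar_scal c theta T) y)).
  { intros c y Hc.
    pose proof (norm_sub_scal_op_ge hX T (polar c theta) y) as H.
    rewrite Cmod_polar in H; try easy.
    fold (polar_scal c theta T y) in H.
    fold (one_minus (polar_scal c theta T) y) in H.
    apply Rle_trans with (M * ((1 - c * numerical_radius T) * norm y)).
    - rewrite -Rmult_assoc. rewrite -{1}(Rmult_1_l (norm y)).
      apply Rmult_le_compat_r; [apply norm_ge_0|].
      assert (c * numerical_radius T <= t * numerical_radius T) by nra.
      nra.
    - now apply Rmult_le_compat_l. }
  assert (Hdiff : norm (minus (u x) (v x)) <= (t - s) * op_norm T * norm x).
  { replace (minus (u x) (v x)) with (polar_scal (t - s) theta T x).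
    - unfold polar_scal. rewrite norm_scal_C Cmod_polar; [|lra].
      rewrite Rmult_assoc. apply Rmult_le_compat_l; [lra|apply norm_op_le].
    - unfold u, v, polar_scal, minus at 1.
      rewrite -(scal_opp_l (polar s theta : C_AbsRing)) -scal_distr_r.
      f_equal. change (polar (t - s) theta = polar t theta + - polar s theta)%C.
      unfold polar, Cplus, Copp; simpl. f_equal; ring. }
  apply (Rle_trans _ _ _ Hdiff).
  rewrite (Rmult_assoc _ (M ^ 2)).
  apply Rmult_le_compat_l.
  { apply Rmult_le_pos; [lra|apply op_norm_ge_0]. }
  assert (H1 : norm x <= M * norm (one_minus v x)) by (apply Hlow; lra).
  assert (H2 : norm (one_minus v x) <= M * norm (one_minus u (one_minus v x)))
    by (apply Hlow; lra).
  nra.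
Qed.

Lemma paranormal_op_norm_le_numerical_radius (T : bounded_op X X) :
  paranormal T -> 0 <= numerical_radius T -> op_norm T <= numerical_radius T.
Proof.
  intros hT Hr.
  destruct (Rle_or_lt (op_norm T) (numerical_radius T)) as [|Hlt]; [easy|].
  exfalso.
  set (a := op_norm T) in *. set (r := numerical_radius T) in *.
  assert (Ha : 0 < a) by lra.
  set (q := r / a).
  assert (Hqa : q * a = r) by (unfold q; field; lra).
  assert (Hq : 0 <= q < 1) by (split; nra).
  (* With [t = (1 + h) / a] and [s = (1 - h) / a] one has [(t - s) * a = 2 h],
     and [h <= (1 - q) / 2] allows [M = 2 / (1 - q)]; the gap is then
     [2 h * M ^ 2], which this [h] makes equal to [1 / 4]. *)
  set (h := (1 - q) ^ 2 / 32).
  assert (Hh : 0 < h) by (unfold h; nra).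
  assert (Hh' : h <= (1 - q) / 2) by (unfold h; nra).
  set (t := (1 + h) / a). set (s := (1 - h) / a).
  assert (Hta : t * a = 1 + h) by (unfold t; field; lra).
  assert (Hsa : s * a = 1 - h) by (unfold s; field; lra).
  assert (Ht0 : 0 < t) by nra. assert (Hs0 : 0 < s) by nra.
  assert (Htr : t * r = (1 + h) * q) by (rewrite -Hqa -Hta; ring).
  assert (Hgap : circle_gap (1/4) t s T).
  { replace (1/4) with ((t - s) * op_norm T * (2 / (1 - q)) ^ 2).
    - apply circle_gap_op.
      + split; nra.
      + easy.
      + left. apply Rdiv_lt_0_compat; lra.
      + fold r. rewrite Htr.
        apply Rmult_le_reg_r with ((1 - q) / 2); [lra|].
        replace (2 / (1 - q) * (1 - (1 + h) * q) * ((1 - q) / 2))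
          with (1 - (1 + h) * q) by (field; lra).
        nra.
    - fold a. replace ((t - s) * a) with (2 * h) by lra.
      unfold h. field. lra. }
  destruct (exists_pow_pow2_le (s * a)) as [k Hk]; [nra|].
  assert (Hbound : forall x, norm x = 1 -> norm (T x) <= / t).
  { intros x Hx.
    apply (Rmult_le_reg_l t); [easy|].
    rewrite Rinv_r; [|lra].
    apply (paranormal_scal_op_le k T a t s); try easy; try lra.
    - apply bounded_op_is_linear.
    - apply norm_op_le. }
  assert (Hle : a <= / t).
  { apply op_norm_le. intros y Hy.
    destruct (Req_dec (norm y) 0) as [H0|Hy0].
    - rewrite (norm_eq_zero y H0) (linear_zero T (bounded_op_is_linear T)).
      rewrite norm_zero. left. now apply Rinv_0_lt_compat.
    - destruct (exists_normalized X y Hy0) as [e [He Hye]].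
      specialize (Hbound e He). pose proof (norm_ge_0 y).
      pose proof (norm_ge_0 (T e)).
      rewrite Hye (linear_scal T (bounded_op_is_linear T)) norm_scal_C.
      rewrite Cmod_R Rabs_pos_eq //. nra. }
  apply (Rmult_le_compat_l t) in Hle; [|lra].
  rewrite Rinv_r in Hle; lra.
Qed.

(** Evaluate [T' (J x) = J (T x)] at [T x]. *)
Lemma self_adjoint_paranormal (T : bounded_op X X) :
  self_adjoint T -> paranormal T.
Proof.
  intros hT x.
  destruct (duality_map_spec hX x) as [Hn _].
  destruct (duality_map_spec hX (T x)) as [_ Hd].
  rewrite -(hT x) in Hd. simpl in Hd.
  pose proof (norm_op_le (duality_map x) (T (T x))) as H.
  rewrite Hn Hd in H.
  change (Cmod (RtoC (norm (T x) ^ 2)) <= norm x * norm (T (T x))) in H.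
  rewrite Cmod_R Rabs_pos_eq in H; [|apply pow2_ge_0].
  lra.
Qed.

Lemma attains_norm_of_op_norm_le (T : bounded_op X X) :
  op_norm T <= numerical_radius T ->
  attains_numerical_radius T -> attains_norm T.
Proof.
  intros Hle [x [Hx Hrx]]. exists x. split; [easy|].
  destruct (duality_map_spec hX x) as [HJ _].
  pose proof (norm_op_le (duality_map x) (T x)) as H1.
  change (norm (duality_map x (T x))) with (Cmod (duality_map x (T x))) in H1.
  pose proof (norm_op_le T x) as H2.
  rewrite HJ Hx in H1. rewrite Hx in H2. lra.
Qed.

End SmoothParanormal.

Theorem proposition4 (X : CompleteNormedModule C_AbsRing) (hX : smooth X) :
  (forall T : bounded_op X X,
      numerical_radius T = op_norm T ->
      attains_numerical_radius T -> attains_norm T) /\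
  (forall T : bounded_op X X,
      self_adjoint T ->
      attains_numerical_radius T -> attains_norm T).
Proof.
  split; intros T hT hatt; apply (attains_norm_of_op_norm_le hX T);
    try assumption.
  - lra.
  - apply (paranormal_op_norm_le_numerical_radius hX T).
    + now apply (self_adjoint_paranormal hX).
    + destruct hatt as [x [_ <-]]. apply Cmod_ge_0.
Qed.
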